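(* Let $n\geq1$, $\varepsilon>0$, and let $\psi:\mathbb{R}\to[0,\infty)$ satisfy $\psi\in C^2(\mathbb{R})$, $\psi(-y)=\psi(y)$, $\psi(0)=0$, $|\psi'(y)|\leq\nu_1$, $\psi(y)\geq\nu_2|y|-\nu_3$ and $\psi''(y)>0$ for all $y\in\mathbb{R}$, with constants $\nu_1,\nu_2>0$, $\nu_3\in\mathbb{R}$ (so $\psi$ is convex and increasing on $[0,\infty)$). Define $$F^*(p):=\sum_{i=1}^n\psi\Big(\sqrt[4]{\varepsilon^2+\sigma_i(p)^2}\Big),\quad p\in\mathbb{R}^{n\times n}.$$ Then $F^*$ is convex and of class $C^2$ on $\mathbb{R}^{n\times n}$.
   Context: For $p\in\mathbb{R}^{n\times n}$, $\sigma_1(p),\dots,\sigma_n(p)$ denote the eigenvalues of the symmetric positive semidefinite matrix $pp^T$ (counted with multiplicity). *)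

(* Defs.v *)
From HB Require Import structures.
From mathcomp Require Import all_boot all_order all_algebra.
From mathcomp Require Import all_classical all_reals all_analysis.
Set Implicit Arguments. Unset Strict Implicit. Unset Printing Implicit Defensive.
Import Order.TTheory GRing.Theory Num.Theory.
Import numFieldNormedType.Exports.
Local Open Scope classical_set_scope.
Local Open Scope ring_scope.

(* The eigenvalues of a square matrix A counted with multiplicity:
   a sequence s of length n with char_poly A = prod_(x <- s) ('X - x).
   (Chosen via classical choice; for symmetric matrices such as p p^T
   it exists, and its order is irrelevant for symmetric sums.) *)
Definition eigenvalues {R : realType} (n : nat) (A : 'M[R]_n) : seq R :=
  xget [::] [set s : seq R | size s = n /\
                 char_poly A = \prod_(x <- s) ('X - x%:P)].

Definition sigmas {R : realType} (n : nat) (p : 'M[R]_n) : seq R :=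
  eigenvalues (p *m p^T).

Definition Fstar {R : realType} (n : nat) (psi : R -> R) (eps : R)
    (p : 'M[R]_n) : R :=
  \sum_(s <- sigmas p) psi (Num.sqrt (Num.sqrt (eps ^+ 2 + s ^+ 2))).

Definition C2_real {R : realType} (f : R -> R) : Prop :=
  (forall x, derivable f x 1) /\
  (forall x, derivable (derive1 f) x 1) /\
  continuous (derive1 (derive1 f)).

Definition C2_on {R : realType} {V : normedModType R} (f : V -> R) : Prop :=
  (forall x, differentiable f x) /\
  (forall v x, differentiable ('D_v f) x) /\
  (forall v w, continuous ('D_w ('D_v f))).

Definition convex_fun {R : realType} {V : lmodType R} (f : V -> R) : Prop :=
  forall (x y : V) (t : R), 0 <= t <= 1 ->
    f (t *: x + (1 - t) *: y) <= t * f x + (1 - t) * f y.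

(* Main.v *)
(** The eigenvalues of the symmetric dilation [D(p) = [[0, p], [p^T, 0]]] are,
    up to sign, the singular values of [p], so that
    [F*(p) = 1/2 tr G(D(p))] with [G(t) = psi((eps^2 + t^4)^(1/4))]. As [D] is
    linear, it is enough to study [A |-> tr G(A)] on symmetric matrices, for a
    function [G] which is convex and of class C^2 on the real line.

    Convexity: [G] lies above its tangents, so Jensen's inequality gives
    [sum_i G(<A u_i, u_i>) <= tr G(A)] for every orthonormal basis [u]
    (Peierls' inequality), with equality for an eigenbasis of [A].

    Regularity: let [u_i, a_i] and [v_j, b_j] be eigenbases and eigenvalues of
    [A] and [B], and let [h^[1]] be the divided difference of [h]. Then
    [<u_i, (h(B) - h(A)) v_j> = h^[1](a_i, b_j) <u_i, (B - A) v_j>], that is,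
    [h(B) - h(A)] is the image of [B - A] under the Schur multiplier
    [h^[1](a_i, b_j)] written in these bases. If [h] is C^1, this linear map
    depends continuously on [A] and [B], although the eigenbases do not: a base
    change from the eigenbasis of [A] to that of a nearby [A0] only mixes
    eigenvalues which are close to each other, since
    [(a_i - a0_k) <u_i, u0_k> = <u_i, (A - A0) u0_k>]. Hence [A |-> h(A)] is
    differentiable with derivative [h^[1](A, A)] (the Daletskii-Krein formula),
    and applying this to [h = G] and to [h = G'] gives the claim. *)

Require Import Defs.
From HB Require Import structures.
From mathcomp Require Import all_boot all_order all_algebra.
From mathcomp Require Import all_classical all_reals all_analysis.
From mathcomp Require Import complex ring lra.
Set Implicit Arguments.
Unset Strict Implicit.
Unset Printing Implicit Defensive.
Import Order.TTheory GRing.Theory Num.Theory.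
Import numFieldNormedType.Exports.
Local Open Scope classical_set_scope.
Local Open Scope ring_scope.

(** * Orthogonal diagonalisation of real symmetric matrices *)

Definition orthogonalmx (R : pzRingType) n (U : 'M[R]_n) : Prop :=
  U *m U^T = 1%:M.

Definition spectral_dec (R : pzRingType) n (A U : 'M[R]_n) (d : 'rV[R]_n) :
    Prop :=
  orthogonalmx U /\ U *m A = diag_mx d *m U.

Section OrthogonalMatrices.
Variable R : comNzRingType.

Lemma orthogonalmx1 n : orthogonalmx (1%:M : 'M[R]_n).
Proof. by rewrite /orthogonalmx trmx1 mulmx1. Qed.

Lemma orthogonalmx_tr n (U : 'M[R]_n) : orthogonalmx U -> orthogonalmx U^T.
Proof. by move=> /mulmx1C UU; rewrite /orthogonalmx trmxK. Qed.

Lemma mulmxKtr m n (U : 'M[R]_n) (B : 'M[R]_(m, n)) :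
  orthogonalmx U -> B *m U *m U^T = B.
Proof. by move=> UU; rewrite -mulmxA UU mulmx1. Qed.

Lemma mulmxKVtr m n (U : 'M[R]_n) (B : 'M[R]_(m, n)) :
  orthogonalmx U -> B *m U^T *m U = B.
Proof. by move=> /orthogonalmx_tr UU; have := mulmxKtr B UU; rewrite trmxK. Qed.

Lemma mulKmxtr m n (U : 'M[R]_m) (B : 'M[R]_(m, n)) :
  orthogonalmx U -> U^T *m (U *m B) = B.
Proof. by move=> /mulmx1C UU; rewrite mulmxA UU mul1mx. Qed.

Lemma mulKVmxtr m n (U : 'M[R]_m) (B : 'M[R]_(m, n)) :
  orthogonalmx U -> U *m (U^T *m B) = B.
Proof. by move=> UU; rewrite mulmxA UU mul1mx. Qed.

Lemma orthogonalmx_conjK m n (U : 'M[R]_m) (V : 'M[R]_n) (M : 'M[R]_(m, n)) :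
  orthogonalmx U -> orthogonalmx V -> U^T *m (U *m M *m V^T) *m V = M.
Proof. by move=> UU VV; rewrite -[U *m M *m _]mulmxA mulKmxtr // mulmxKVtr. Qed.

Lemma orthogonalmxM n (U V : 'M[R]_n) :
  orthogonalmx U -> orthogonalmx V -> orthogonalmx (U *m V).
Proof. by move=> UU VV; rewrite /orthogonalmx trmx_mul mulmxA mulmxKtr. Qed.

Lemma orthogonalmx_sum_row_sqr n (U : 'M[R]_n) i :
  orthogonalmx U -> \sum_k U i k ^+ 2 = 1.
Proof.
move=> /matrixP/(_ i i); rewrite !mxE eqxx mulr1n => <-.
by apply: eq_bigr => k _; rewrite mxE expr2.
Qed.

Lemma spectral_decE n (A U : 'M[R]_n) d :
  spectral_dec A U d -> A = U^T *m diag_mx d *m U.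
Proof. by move=> [UU UA]; rewrite -mulmxA -UA mulKmxtr. Qed.

Lemma spectral_dec_diag n (d : 'rV[R]_n) : spectral_dec (diag_mx d) 1%:M d.
Proof. by split; [exact: orthogonalmx1 | rewrite mulmx1 mul1mx]. Qed.

Lemma spectral_dec_conj n (A H U : 'M[R]_n) d : orthogonalmx H ->
  spectral_dec (H *m A *m H^T) U d -> spectral_dec A (U *m H) d.
Proof.
move=> HH [UU UA]; split; first exact: orthogonalmxM.
by rewrite mulmxA -UA !mulmxA mulmxKVtr.
Qed.

Lemma spectral_dec_block m n (A U : 'M[R]_m) d (B V : 'M[R]_n) e :
  spectral_dec A U d -> spectral_dec B V e ->
  spectral_dec (block_mx A 0 0 B) (block_mx U 0 0 V) (row_mx d e).
Proof.
move=> [UU UA] [VV VB]; split.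
  rewrite /orthogonalmx tr_block_mx !trmx0 mulmx_block !mulmx0 !mul0mx.
  by rewrite !addr0 !add0r UU VV -scalar_mx_block.
rewrite diag_mx_row !mulmx_block !mulmx0 !mul0mx !addr0 !add0r.
by rewrite UA VB.
Qed.

Lemma spectral_dec_sqr n (A U : 'M[R]_n) d : spectral_dec A U d ->
  spectral_dec (A *m A) U (\row_i (d 0 i ^+ 2)).
Proof.
move=> [UU UA]; split=> //.
by rewrite mulmxA UA -mulmxA UA mulmxA mulmx_diag.
Qed.

End OrthogonalMatrices.

Lemma symmetric_eigenvalue (R : rcfType) n (A : 'M[R]_n) :
  (0 < n)%N -> A^T = A -> exists a, eigenvalue A a.
Proof.
move=> n_gt0 symA; pose AC := map_mx (real_complex R) A.
have [z] := eigenvalue_closed AC n_gt0.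
move=> /[dup] + /eigenvalueP[v vA v_neq0] => eigenz.
have hermA : (AC^t*)%sesqui = AC.
  apply/matrixP => i j; rewrite !mxE -[in RHS]symA mxE.
  by apply/CrealP/complex_realP; exists (A j i).
have : z \is Num.real.
  apply/CrealP; have /lt0r_neq0 vv_neq0 := dotmx_is_dotmx v_neq0.
  apply: (mulIf vv_neq0); rewrite !dotmxE.
  have := congr1 (fun w => (w *m (v^t*)%sesqui) 0 0) vA.
  rewrite -scalemxAl [RHS]mxE => <-.
  rewrite -mulmxA -hermA -map_mxM -trmx_mul vA linearZ/= map_mxZ/= -scalemxAr.
  by rewrite [RHS]mxE.
move=> /complex_realP[a za]; exists a.
by move: eigenz; rewrite za eigenvalue_map.
Qed.

Section Reflection.
Variables (R : realFieldType) (n : nat).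
Implicit Types u v w : 'rV[R]_n.

Local Notation "''[' u , v ]" := ((u *m v^T) 0 0).

Lemma dotrC u v : '[u, v] = '[v, u].
Proof. by rewrite !mxE; apply: eq_bigr => i _; rewrite !mxE mulrC. Qed.

Lemma dotr_eq0 u : ('[u, u] == 0) = (u == 0).
Proof.
rewrite mxE psumr_eq0 => [|i _]; last by rewrite mxE -expr2 sqr_ge0.
apply/allP/eqP => [u0|-> i _]; last by rewrite !mxE mulr0 eqxx.
apply/rowP => i; have := u0 i (mem_index_enum i).
by rewrite !mxE -expr2 sqrf_eq0 => /eqP.
Qed.

Lemma dotr_ge0 u : 0 <= '[u, u].
Proof. by rewrite mxE sumr_ge0 // => i _; rewrite mxE -expr2 sqr_ge0. Qed.

(* The identity when [w = 0], as [2 / 0 = 0]. *)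
Definition reflection w : 'M[R]_n := 1%:M - (2 / '[w, w]) *: (w^T *m w).

Lemma mulmx_reflection u w :
  u *m reflection w = u - (2 / '[w, w] * '[u, w]) *: w.
Proof.
rewrite mulmxBr mulmx1 -scalemxAr mulmxA [X in _ *: (X *m _)]mx11_scalar.
by rewrite mul_scalar_mx scalerA.
Qed.

Lemma trmx_reflection w : (reflection w)^T = reflection w.
Proof. by rewrite /reflection linearB/= trmx1 linearZ/= trmx_mul trmxK. Qed.

Lemma orthogonalmx_reflection w : orthogonalmx (reflection w).
Proof.
rewrite /orthogonalmx trmx_reflection; apply/row_matrixP => i.
rewrite !rowE mulmxA mulmx1; move: (delta_mx 0 i) => u.
rewrite !mulmx_reflection mulmxBl -scalemxAl; set c := '[w, w].
have -> (a : R) : ((u *m w^T) - a *: (w *m w^T)) 0 0 = '[u, w] - a * c.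
  by rewrite mxE [X in _ + X]mxE [X in _ - X]mxE.
have [->|w_neq0] := eqVneq w 0; first by rewrite !scaler0 !subr0.
have c_neq0 : c != 0 by rewrite dotr_eq0.
rewrite -addrA -opprD -scalerDl (_ : 2 / c * _ + _ = 0) ?scale0r ?subr0 //.
by field.
Qed.

Lemma mulmx_reflection_sub u v :
  '[u, u] = '[v, v] -> u *m reflection (u - v) = v.
Proof.
move=> uv; rewrite mulmx_reflection; set w := u - v.
have [w0|w_neq0] := eqVneq w 0.
  by rewrite w0 scaler0 subr0; apply/subr0_eq.
have ww : '[w, w] = 2 * '[u, w].
  have dotBr x y z : '[x, y - z] = '[x, y] - '[x, z].
    by rewrite linearB/= mulmxBr mxE [X in _ + X]mxE.
  by rewrite dotBr !(dotrC w) !dotBr (dotrC v u) -uv; ring.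
by rewrite mulrAC -ww divff ?dotr_eq0 // scale1r; exact: subKr.
Qed.

End Reflection.

Section SpectralTheorem.
Variable R : rcfType.

Lemma symmetric_unit_eigenvector n (A : 'M[R]_n) : (0 < n)%N -> A^T = A ->
  exists a (u : 'rV_n), u *m u^T = 1%:M /\ u *m A = a *: u.
Proof.
move=> n_gt0 symA.
have [a /eigenvalueP[v vA v_neq0]] := symmetric_eigenvalue n_gt0 symA.
pose c := (v *m v^T) 0 0.
have c_gt0 : 0 < c by rewrite lt_def dotr_eq0 v_neq0 dotr_ge0.
exists a, ((Num.sqrt c)^-1 *: v).
split; last by rewrite -scalemxAl vA !scalerA mulrC.
rewrite linearZ/= -scalemxAl -scalemxAr [v *m _]mx11_scalar -/c.
by rewrite !scale_scalar_mx mulrA -invfM -expr2 sqr_sqrtr ?ltW // mulVf ?gt_eqF.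
Qed.

Lemma symmetric_delta0_block n (M : 'M[R]_(1 + n)) a : M^T = M ->
  delta_mx 0 0 *m M = a *: (delta_mx 0 0 : 'rV_(1 + n)) ->
  M = block_mx (diag_mx (const_mx a)) 0 0 (drsubmx M).
Proof.
move=> symM M0; have M0E j : M 0 j = a *+ (j == 0).
  by have /rowP/(_ j) := M0; rewrite -rowE !mxE mulr_natr.
have ur0 : ursubmx M = 0.
  by apply/matrixP => i j; rewrite !ord1 !mxE lshift0 M0E.
have ul0 : ulsubmx M = diag_mx (const_mx a).
  by apply/matrixP => i j; rewrite !ord1 !mxE lshift0 M0E.
by rewrite -[LHS]submxK -[dlsubmx M]trmxK trmx_dlsub symM ur0 ul0 trmx0.
Qed.

Theorem symmetric_spectral_dec n (A : 'M[R]_n) : A^T = A ->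
  exists U d, spectral_dec A U d.
Proof.
elim: n A => [|n IHn] A symA.
  by exists 1%:M, 0; split; apply/matrixP => -[].
have [a [u [uu uA]]] := symmetric_unit_eigenvector (ltn0Sn n) symA.
pose e0 : 'rV[R]_(1 + n) := delta_mx 0 0; pose H := reflection (e0 - u).
have HH : orthogonalmx H := orthogonalmx_reflection _.
have eH : e0 *m H = u.
  apply: mulmx_reflection_sub; rewrite uu trmx_delta mul_delta_mx !mxE.
  by rewrite !eqxx.
pose M : 'M[R]_(1 + n) := H *m A *m H^T.
have symM : M^T = M by rewrite !trmx_mul trmxK symA mulmxA.
have ME : M = block_mx (diag_mx (const_mx a)) 0 0 (drsubmx M).
  apply: symmetric_delta0_block symM _.
  by rewrite !mulmxA eH uA -scalemxAl -eH mulmxKtr.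
have [|U [d sM]] := IHn (drsubmx M); first by rewrite trmx_drsub symM.
exists (block_mx 1%:M 0 0 U *m H), (row_mx (const_mx a) d : 'rV_(1 + n)).
apply: spectral_dec_conj HH _; rewrite -/M ME.
exact: spectral_dec_block (spectral_dec_diag _) sM.
Qed.

End SpectralTheorem.

(** * Real functions *)

Section CompactModulus.
Variables (R : realType) (V W : normedModType R).
Implicit Types (f : V -> W) (S : set V) (e : R).

Lemma compact_uniform_modulus f S e : compact S -> continuous f -> 0 < e ->
  exists2 r, 0 < r & forall x y, S x -> `|x - y| < r -> `|f x - f y| <= e.
Proof.
move=> /compact_near_coveringP cS cf e_gt0.
have : \forall r \near 0^'+,
    S `<=` [set x | forall y, `|x - y| < r -> `|f x - f y| <= e].
  apply: cS => x0 _.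
  have e2 : 0 < e / 2 by rewrite divr_gt0.
  have /cvgrPdist_le/(_ _ e2)/nbhs_ballP[r /= r_gt0 near_x0] := cf x0.
  have r2 : 0 < r / 2 by rewrite divr_gt0.
  exists (ball x0 (r / 2), [set s | s < r / 2]) => /=.
    by split; [exact: nbhsx_ballx | exact: nbhs_right_lt].
  move=> [x s] [/= x0x sr] y xy.
  have x_near : ball x0 r x by apply: le_ball x0x; lra.
  have y_near : ball x0 r y.
    rewrite [r]splitr; apply: ball_triangle x0x _.
    by rewrite -ball_normE /=; lra.
  rewrite -(subrKA (f x0)) (le_trans (ler_normD _ _)) // [leRHS]splitr lerD //.
  - by rewrite distrC; exact: near_x0.
  - exact: near_x0.
move=> near_r.
have [r [r_gt0 Sr]] := filter_ex (filterI (nbhs_right_gt (0 : R)) near_r).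
by exists r => // x y /Sr; exact.
Qed.

(* Away from the diagonal, the linear term takes over from the modulus of
   continuity because [f] is bounded. *)
Lemma compact_affine_modulus f S e : compact S -> continuous f -> 0 < e ->
  exists2 K, 0 <= K &
    forall x y, S x -> S y -> `|f x - f y| <= e + K * `|x - y|.
Proof.
move=> cS cf e_gt0.
have [r r_gt0 f_near] := compact_uniform_modulus cS cf e_gt0.
have /compact_bounded/ex_strict_bound_gt0[M M_gt0 fM] : compact (f @` S).
  by apply: continuous_compact => //; exact: continuous_subspaceT.
have K_ge0 : 0 <= 2 * M / r by rewrite divr_ge0 ?mulr_ge0 // ltW.
exists (2 * M / r) => // x y Sx Sy.
have [xy_near|xy_far] := ltP `|x - y| r.
  by apply: ler_wpDr; [exact: mulr_ge0 | exact: f_near].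
have fMx := fM _ (imageP f Sx); have fMy := fM _ (imageP f Sy).
apply/ler_wpDl/(le_trans (ler_normB _ _)); first exact: ltW.
rewrite /= in fMx fMy; apply: (@le_trans _ _ (2 * M)); first by lra.
by rewrite mulrAC ler_pdivlMr // ler_wpM2l // mulr_ge0 // ltW.
Qed.

End CompactModulus.

Section DerivableFunctions.
Variables (R : realType).
Implicit Types (f g h : R -> R) (x y c : R).

Lemma is_derive_derive1 h x : derivable h x 1 -> is_derive x 1 h (derive1 h x).
Proof. by rewrite derive1E => /derivableP. Qed.

Lemma derive1_is_derive h h1 :
  (forall x, is_derive x 1 h (h1 x)) -> derive1 h = h1.
Proof.
by move=> dh; apply/funext => x; rewrite derive1E; exact: derive_val.
Qed.

Lemma derivable_continuous h : (forall x, derivable h x 1) -> continuous h.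
Proof. by move=> dh x; apply/differentiable_continuous/derivable1_diffP. Qed.

Definition ddiff h (z : R * R) : R :=
  if z.1 == z.2 then derive1 h z.1 else (h z.2 - h z.1) / (z.2 - z.1).

Lemma ddiff_eq h x : ddiff h (x, x) = derive1 h x.
Proof. by rewrite /ddiff eqxx. Qed.

Lemma ddiffE h x y : h y - h x = ddiff h (x, y) * (y - x).
Proof.
rewrite /ddiff/=; have [->|xy] := eqVneq x y; first by rewrite !subrr mulr0.
by rewrite divfK // subr_eq0 eq_sym.
Qed.

Lemma ddiffC h x y : ddiff h (x, y) = ddiff h (y, x).
Proof.
rewrite /ddiff/= eq_sym; case: eqVneq => [->//|_].
by rewrite -opprB -[y - x]opprB invrN mulrNN.
Qed.

Lemma ddiff_MVT h x y : (forall z, derivable h z 1) -> x <= y ->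
  exists2 c, ddiff h (x, y) = derive1 h c & x <= c <= y.
Proof.
move=> dh; rewrite le_eqVlt => /predU1P[->|xy].
  by exists y; rewrite ?ddiff_eq ?lexx.
have [|c cxy hc] := MVT xy (fun z _ => is_derive_derive1 (dh z)).
  by apply: continuous_subspaceT; exact: derivable_continuous.
exists c; last by move: cxy; rewrite in_itv/= => /andP[/ltW-> /ltW->].
by rewrite /ddiff/= lt_eqF // hc mulfK // subr_eq0 gt_eqF.
Qed.

Lemma ddiff_continuous h : (forall x, derivable h x 1) ->
  continuous (derive1 h) -> continuous (ddiff h).
Proof.
move=> dh ch' [a b]; have [<-|ab] := eqVneq a b.
  apply/cvgrPdist_le => e e_gt0; rewrite ddiff_eq.
  have /cvgrPdist_le/(_ e e_gt0)/nbhs_ballP[r /= r_gt0 near_a] := ch' a.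
  exists (ball a r, ball a r); first by split; exact: nbhsx_ballx.
  move=> [x y] [/=]; wlog xy : x y / x <= y => [le_case|ax ay].
    have [/le_case//|/ltW/le_case yx ax ay] := leP x y.
    by rewrite ddiffC; apply: yx.
  have [c -> cxy] := ddiff_MVT dh xy; apply: near_a.
  by move: ax ay; rewrite -!ball_normE /= !ltr_norml; lra.
have ch := derivable_continuous dh.
have fst_ab : z.1 @[z --> (a, b)] --> a by exact: cvg_fst.
have snd_ab : z.2 @[z --> (a, b)] --> b by exact: cvg_snd.
have neq_ab : \forall z \near (a, b), z.1 != z.2.
  near=> z; rewrite eq_sym -subr_eq0; near: z.
  by apply: (cvgr_neq0 (b - a)); [exact: cvgB | rewrite subr_eq0 eq_sym].
have ddiff_ab : ddiff h (a, b) = (h b - h a) / (b - a).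
  by rewrite /ddiff (negPf ab).
rewrite /continuous_at ddiff_ab.
apply: (cvg_trans (near_eq_cvg _)); last first.
  apply: (cvgM (f := fun z : R * R => h z.2 - h z.1)).
    apply: cvgB; first exact: (cvg_comp _ _ snd_ab (ch b)).
    exact: (cvg_comp _ _ fst_ab (ch a)).
  by apply: cvgV (cvgB snd_ab fst_ab); rewrite subr_eq0 eq_sym.
by apply: filterS neq_ab => z; rewrite /ddiff => /negPf->.
Unshelve. all: by end_near. Qed.

Lemma derive2_ge0_tangent f : (forall x, derivable f x 1) ->
  (forall x, derivable (derive1 f) x 1) ->
  (forall x, 0 <= derive1 (derive1 f) x) -> forall x y,
  f x + derive1 f x * (y - x) <= f y.
Proof.
move=> df df1 f2_ge0 x y.
have f1_ndecr u v : u <= v -> derive1 f u <= derive1 f v.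
  move=> uv; rewrite -subr_ge0 ddiffE mulr_ge0 ?subr_ge0 //.
  by have [c -> _] := ddiff_MVT df1 uv.
rewrite -lerBrDl ddiffE; have [xy|/ltW yx] := leP x y.
  have [c -> /andP[xc _]] := ddiff_MVT df xy.
  by rewrite ler_wpM2r ?subr_ge0 // f1_ndecr.
have [c + /andP[_ cx]] := ddiff_MVT df yx; rewrite ddiffC => ->.
by rewrite ler_wnM2r ?subr_le0 // f1_ndecr.
Qed.

Lemma derive1_ge0_gt_min f a t : (forall x, derivable f x 1) ->
  (forall x, derivable (derive1 f) x 1) ->
  (forall x, 0 <= derive1 (derive1 f) x) -> (forall x, f a <= f x) ->
  a < t -> 0 <= derive1 f t.
Proof.
move=> df df1 f2_ge0 min_a a_lt_t.
rewrite -(pmulr_lge0 _ (_ : 0 < t - a)) ?subr_gt0 //.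
by have := derive2_ge0_tangent df df1 f2_ge0 t a; have := min_a t; nra.
Qed.

Lemma is_derive_C2_real f f1 f2 : (forall x, is_derive x 1 f (f1 x)) ->
  (forall x, is_derive x 1 f1 (f2 x)) -> continuous f2 -> C2_real f.
Proof.
move=> df df1 cf2.
rewrite /C2_real (derive1_is_derive df) (derive1_is_derive df1).
by split=> [x|]; [case: (df x) | split=> [x|//]; case: (df1 x)].
Qed.

Lemma C2_realMl (k : R) f : C2_real f -> C2_real (fun x => k * f x).
Proof.
move=> [df [df1 cf2]].
apply: (@is_derive_C2_real _ (fun x => k * derive1 f x)
  (fun x => k * derive1 (derive1 f) x)).
- by move=> x; exact: (is_deriveZ k (is_derive_derive1 (df x))).
- by move=> x; exact: (is_deriveZ k (is_derive_derive1 (df1 x))).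
- by move=> x; apply: cvgM; [exact: cvg_cst | exact: cf2].
Qed.

Section Composition.
Variables f g : R -> R.
Hypotheses (C2f : C2_real f) (C2g : C2_real g).

Let fg1 x := derive1 f (g x) * derive1 g x.

Let fg2 x := derive1 f (g x) * derive1 (derive1 g) x +
  derive1 g x * (derive1 (derive1 f) (g x) * derive1 g x).

Let is_derive_comp x : is_derive x 1 (f \o g) (fg1 x).
Proof.
apply: is_derive1_comp; apply: is_derive_derive1; first exact: C2f.1.
exact: C2g.1.
Qed.

Let is_derive2_comp x : is_derive x 1 fg1 (fg2 x).
Proof.
have df1g := is_derive1_comp
  (is_derive_derive1 (C2f.2.1 _)) (is_derive_derive1 (C2g.1 x)).
exact: (is_deriveM df1g (is_derive_derive1 (C2g.2.1 x))).
Qed.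

Lemma derive2_comp x : derive1 (derive1 (f \o g)) x =
  derive1 f (g x) * derive1 (derive1 g) x +
  derive1 g x * (derive1 (derive1 f) (g x) * derive1 g x).
Proof.
rewrite (derive1_is_derive is_derive_comp).
by rewrite (derive1_is_derive is_derive2_comp).
Qed.

Lemma derive2_comp_ge0 x : 0 <= derive1 f (g x) ->
  0 <= derive1 (derive1 f) (g x) -> 0 <= derive1 (derive1 g) x ->
  0 <= derive1 (derive1 (f \o g)) x.
Proof.
rewrite derive2_comp; move: (derive1 f _) (derive1 (derive1 f) _) (derive1 g x).
move: (derive1 (derive1 g) x) => g2 f1 f2 g1 f1_ge0 f2_ge0 g2_ge0.
by rewrite mulrCA -expr2 addr_ge0 // mulr_ge0 ?sqr_ge0.
Qed.

Lemma C2_real_comp : C2_real (f \o g).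
Proof.
apply: is_derive_C2_real is_derive_comp is_derive2_comp _.
have [df [df1 cf2]] := C2f; have [dg [dg1 cg2]] := C2g.
have cg := derivable_continuous dg; have cg1 := derivable_continuous dg1.
have c_comp h : continuous h -> continuous (h \o g).
  by move=> ch x; apply: continuous_comp; [exact: cg | exact: ch].
move=> x; apply: cvgD; apply: cvgM.
- exact: (c_comp _ (derivable_continuous df1)).
- exact: cg2.
- exact: cg1.
- by apply: cvgM; [exact: (c_comp _ cf2) | exact: cg1].
Qed.

End Composition.

End DerivableFunctions.

(** * Functional calculus *)

Section SpectralDecomposition.
Variables (R : rcfType) (n : nat).
Implicit Types A B C : 'M[R]_n.

Definition spectral_pair A : 'M[R]_n * 'rV[R]_n :=
  xget (1%:M, 0) [set Ud | spectral_dec A Ud.1 Ud.2].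

Definition eigenbasis A : 'M[R]_n := (spectral_pair A).1.

Definition spectrum A : 'rV[R]_n := (spectral_pair A).2.

Lemma spectral_decP A :
  A^T = A -> spectral_dec A (eigenbasis A) (spectrum A).
Proof.
move=> /symmetric_spectral_dec[U [d sA]].
rewrite /eigenbasis /spectrum /spectral_pair.
by case: xgetP => [Ud -> //|/(_ (U, d))].
Qed.

Lemma orthogonalmx_eigenbasis A : orthogonalmx (eigenbasis A).
Proof.
rewrite /eigenbasis /spectral_pair; case: xgetP => [Ud -> [] //|_ /=].
exact: orthogonalmx1.
Qed.

Local Hint Resolve orthogonalmx_eigenbasis : core.

(* The entries [<u_i, C v_j>] for the eigenbases [u] of [A] and [v] of [B]. *)
Definition eigencoord A B C : 'M[R]_n :=
  eigenbasis A *m C *m (eigenbasis B)^T.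

Lemma eigencoord_linear A B : linear (eigencoord A B).
Proof.
by move=> a C D; rewrite /eigencoord mulmxDr mulmxDl -scalemxAr -scalemxAl.
Qed.

HB.instance Definition _ A B :=
  GRing.isLinear.Build R 'M[R]_n 'M[R]_n *:%R (eigencoord A B)
    (@eigencoord_linear A B).

Lemma eigencoordK A B : cancel (eigencoord A B)
  (fun X => (eigenbasis A)^T *m X *m eigenbasis B).
Proof. by move=> C; exact: orthogonalmx_conjK. Qed.

Lemma eigencoordVK A B : cancel
  (fun X => (eigenbasis A)^T *m X *m eigenbasis B) (eigencoord A B).
Proof.
move=> X; rewrite /eigencoord -!mulmxA mulKVmxtr //.
by rewrite mulmxA mulmxKtr.
Qed.

Lemma eigencoord_spectrum A :
  A^T = A -> eigencoord A A A = diag_mx (spectrum A).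
Proof. by move=> /spectral_decP[UU UA]; rewrite /eigencoord UA mulmxKtr. Qed.

Definition overlap A B : 'M[R]_n := eigenbasis A *m (eigenbasis B)^T.

Lemma orthogonalmx_overlap A B : orthogonalmx (overlap A B).
Proof. by apply: orthogonalmxM => //; exact: orthogonalmx_tr. Qed.

Lemma eigencoord_overlap A0 B0 A B C : eigencoord A B C =
  overlap A A0 *m eigencoord A0 B0 C *m (overlap B B0)^T.
Proof.
by rewrite /eigencoord /overlap trmx_mul trmxK !mulmxA !mulmxKVtr.
Qed.

End SpectralDecomposition.

#[local] Hint Extern 0 (orthogonalmx (eigenbasis _)) =>
  exact: orthogonalmx_eigenbasis : core.

Section FunctionalCalculus.
Variables (R : rcfType) (n : nat).
Implicit Types (A B C : 'M[R]_n) (h : R -> R) (phi : R * R -> R).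

Definition mxfun h A : 'M[R]_n :=
  (eigenbasis A)^T *m diag_mx (map_mx h (spectrum A)) *m eigenbasis A.

Lemma mxfun_id A : A^T = A -> mxfun id A = A.
Proof. by move=> /spectral_decP/spectral_decE sA; rewrite /mxfun map_mx_id. Qed.

Lemma mxtrace_mxfun h A : \tr (mxfun h A) = \sum_i h (spectrum A 0 i).
Proof.
rewrite /mxfun -mulmxA mxtrace_mulC mulmxKtr // mxtrace_diag.
by apply: eq_bigr => i _; rewrite mxE.
Qed.

Lemma eigencoord_mxfunB h A B i j :
  eigencoord A B (mxfun h B - mxfun h A) i j =
  (h (spectrum B 0 j) - h (spectrum A 0 i)) * overlap A B i j.
Proof.
have -> : eigencoord A B (mxfun h B - mxfun h A) =
    overlap A B *m diag_mx (map_mx h (spectrum B)) -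
    diag_mx (map_mx h (spectrum A)) *m overlap A B.
  rewrite linearB /= /eigencoord /mxfun /overlap !mulmxA mulmxKtr //.
  by rewrite (orthogonalmx_eigenbasis A) mul1mx -mulmxA.
by rewrite mul_mx_diag mul_diag_mx !mxE; ring.
Qed.

Lemma eigencoordB A B i j : A^T = A -> B^T = B ->
  eigencoord A B (B - A) i j =
  (spectrum B 0 j - spectrum A 0 i) * overlap A B i j.
Proof.
by move=> symA symB; have := eigencoord_mxfunB id A B i j; rewrite !mxfun_id.
Qed.

(* The Schur multiplier [phi (a, b)], with [a] ranging over the eigenvalues of
   [A] and [b] over those of [B], applied to [C]; in the literature, the double
   operator integral of [phi]. *)
Definition double_opint phi A B C : 'M[R]_n :=
  (eigenbasis A)^T *m
  (\matrix_(i, j)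
    (phi (spectrum A 0 i, spectrum B 0 j) * eigencoord A B C i j)) *m
  eigenbasis B.

Lemma eigencoord_double_opint phi A B C i j :
  eigencoord A B (double_opint phi A B C) i j =
  phi (spectrum A 0 i, spectrum B 0 j) * eigencoord A B C i j.
Proof. by rewrite eigencoordVK mxE. Qed.

Lemma double_opint_linear phi A B : linear (double_opint phi A B).
Proof.
move=> a C D; apply: (can_inj (@eigencoordK _ _ A B)); apply/matrixP => i j.
rewrite linearP /= [RHS]mxE [X in _ = X + _]mxE !eigencoord_double_opint.
by rewrite linearP /= [X in _ * X]mxE [X in _ * (X + _)]mxE; ring.
Qed.

HB.instance Definition _ phi A B :=
  GRing.isLinear.Build R 'M[R]_n 'M[R]_n *:%R (double_opint phi A B)
    (@double_opint_linear phi A B).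

Lemma mxtrace_double_opint phi A C :
  \tr (double_opint phi A A C) = \tr (mxfun (fun t => phi (t, t)) A *m C).
Proof.
rewrite /double_opint /mxfun -mulmxA mxtrace_mulC mulmxKtr //.
rewrite -!mulmxA mxtrace_mulC -!mulmxA (mulmxA _ C) mul_diag_mx.
by apply: eq_bigr => i _; rewrite !mxE.
Qed.

End FunctionalCalculus.

Lemma mxfun_sub (R : realType) n (h : R -> R) (A B : 'M[R]_n) :
  A^T = A -> B^T = B ->
  mxfun h B - mxfun h A = double_opint (ddiff h) A B (B - A).
Proof.
move=> symA symB; apply: (can_inj (@eigencoordK _ _ A B)).
apply/matrixP => i j; rewrite eigencoord_mxfunB eigencoord_double_opint.
by rewrite eigencoordB // mulrA -ddiffE.
Qed.

(** * Continuity of double operator integrals *)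

Section MatrixNorm.
Variable R : realType.

Lemma mx_entry_le_norm m n (A : 'M[R]_(m, n)) i j : `|A i j| <= `|A|.
Proof.
rewrite [leRHS]/Num.norm/= mx_normrE.
by apply/bigmax_geP; right; exists (i, j).
Qed.

Lemma mx_norm_le m n (A : 'M[R]_(m, n)) c :
  0 <= c -> (forall i j, `|A i j| <= c) -> `|A| <= c.
Proof. by move=> c_ge0 Ac; rewrite [leLHS]/Num.norm/= mx_normrE bigmax_le. Qed.

Lemma norm_sum_ord_le n (F : 'I_n -> R) c :
  (forall k, `|F k| <= c) -> `|\sum_k F k| <= n%:R * c.
Proof.
move=> Fc; apply: le_trans (ler_norm_sum _ _ _) _.
by rewrite mulr_natl -[n in leRHS]card_ord -sumr_const ler_sum.
Qed.

Lemma mulmx_norm_le m n p (A : 'M[R]_(m, n)) (B : 'M[R]_(n, p)) :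
  `|A *m B| <= n%:R * (`|A| * `|B|).
Proof.
apply: mx_norm_le => [|i j]; first by rewrite !mulr_ge0.
rewrite mxE; apply: norm_sum_ord_le => k.
by rewrite normrM ler_pM ?mx_entry_le_norm.
Qed.

Lemma mx_linear_continuous m n (W : normedModType R)
  (f : {linear 'M[R]_(m, n) -> W}) : continuous f.
Proof.
apply: bounded_linear_continuous; apply/bounded_funP => r.
exists (r * \sum_i \sum_j `|f (delta_mx i j)|) => A Ar.
rewrite {1}(matrix_sum_delta A) mulr_sumr linear_sum.
rewrite (le_trans (ler_norm_sum _ _ _)) // ler_sum // => i _.
rewrite mulr_sumr linear_sum.
rewrite (le_trans (ler_norm_sum _ _ _)) // ler_sum // => j _.
rewrite linearZ normrZ ler_wpM2r // (le_trans _ Ar) //.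
exact: mx_entry_le_norm.
Qed.

Lemma orthogonalmx_norm_le1 n (U : 'M[R]_n) : orthogonalmx U -> `|U| <= 1.
Proof.
move=> UU; apply: mx_norm_le => // i j.
rewrite -(@ler_pXn2r _ 2) ?nnegrE // expr1n real_normK ?num_real //.
rewrite -(orthogonalmx_sum_row_sqr i UU) (bigD1 j)//= lerDl.
by apply: sumr_ge0 => k _; rewrite sqr_ge0.
Qed.

Lemma orthogonalmx_conj_norm_le n (U V C : 'M[R]_n) :
  orthogonalmx U -> orthogonalmx V ->
  `|U *m C *m V^T| <= n%:R ^+ 2 * `|C|.
Proof.
move=> /orthogonalmx_norm_le1 U1 /orthogonalmx_tr/orthogonalmx_norm_le1 V1.
rewrite expr2 -mulrA (le_trans (mulmx_norm_le _ _)) // ler_wpM2l //.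
rewrite (le_trans (ler_piMr _ V1)) // (le_trans (mulmx_norm_le _ _)) //.
by rewrite ler_wpM2l // ler_piMl.
Qed.

End MatrixNorm.

Section ContinuousDoubleOpint.
Variables (R : realType) (n : nat).
Implicit Types (A B C : 'M[R]_n) (phi : R * R -> R).

Local Notation N2 := (n%:R ^+ 2 : R).

Lemma eigencoord_entry_le A B C i j :
  `|eigencoord A B C i j| <= N2 * `|C|.
Proof.
by rewrite (le_trans (mx_entry_le_norm _ _ _)) // orthogonalmx_conj_norm_le.
Qed.

Lemma norm_le_eigencoord A B C : `|C| <= N2 * `|eigencoord A B C|.
Proof.
rewrite -{1}[C](eigencoordK A B) -[X in _ *m X]trmxK.
by apply: orthogonalmx_conj_norm_le; exact: orthogonalmx_tr.
Qed.

Lemma spectrum_le_norm A i : A^T = A -> `|spectrum A 0 i| <= N2 * `|A|.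
Proof.
move=> symA; have := eigencoord_entry_le A A A i i.
by rewrite eigencoord_spectrum // mxE eqxx mulr1n.
Qed.

Lemma overlap_entry_le1 A B i j : `|overlap A B i j| <= 1.
Proof.
apply: le_trans (mx_entry_le_norm _ _ _) _.
exact/orthogonalmx_norm_le1/orthogonalmx_overlap.
Qed.

Lemma spectrum_gap_overlap_le A B i j : A^T = A -> B^T = B ->
  `|spectrum A 0 i - spectrum B 0 j| * `|overlap A B i j| <= N2 * `|A - B|.
Proof.
move=> symA symB; rewrite distrC -normrM -eigencoordB // (distrC A).
exact: eigencoord_entry_le.
Qed.

Lemma eigencoord_double_opintB phi A B A0 B0 C i j :
  eigencoord A B (double_opint phi A B C - double_opint phi A0 B0 C) i j =
  \sum_k \sum_l
    (phi (spectrum A 0 i, spectrum B 0 j) -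
     phi (spectrum A0 0 k, spectrum B0 0 l)) *
    (overlap A A0 i k * overlap B B0 j l) * eigencoord A0 B0 C k l.
Proof.
have change_basis D : eigencoord A B D i j = \sum_k \sum_l
    overlap A A0 i k * overlap B B0 j l * eigencoord A0 B0 D k l.
  rewrite (eigencoord_overlap A0 B0) exchange_big mxE.
  apply: eq_bigr => l _; rewrite mxE mulr_suml.
  by apply: eq_bigr => k _; rewrite [_^T l j]mxE; ring.
rewrite linearB /= mxE eigencoord_double_opint [X in _ + X]mxE !change_basis.
rewrite mulr_sumr -sumrB; apply: eq_bigr => k _.
rewrite mulr_sumr -sumrB; apply: eq_bigr => l _.
by rewrite eigencoord_double_opint; ring.
Qed.

(* The term in [K] is under control because the overlap of two eigenvectors is
   small when their eigenvalues are far apart. *)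
Lemma double_opint_sub_le phi (e K : R) A B A0 B0 C : 0 <= e -> 0 <= K ->
  A^T = A -> B^T = B -> A0^T = A0 -> B0^T = B0 ->
  (forall i j k l,
    `|phi (spectrum A 0 i, spectrum B 0 j) -
      phi (spectrum A0 0 k, spectrum B0 0 l)| <=
    e + K * (`|spectrum A 0 i - spectrum A0 0 k| +
             `|spectrum B 0 j - spectrum B0 0 l|)) ->
  `|double_opint phi A B C - double_opint phi A0 B0 C| <=
    N2 ^+ 3 * (e + K * (N2 * (`|A - A0| + `|B - B0|))) * `|C|.
Proof.
move=> e_ge0 K_ge0 symA symB symA0 symB0 phi_le; set m := e + K * (N2 * _).
have m_ge0 : 0 <= m by rewrite addr_ge0 // !mulr_ge0 // ?exprn_ge0 ?addr_ge0.
apply: le_trans (norm_le_eigencoord A B _) _.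
rewrite (_ : N2 ^+ 3 * m * _ = N2 * (N2 * (m * (N2 * `|C|)))); last by ring.
rewrite ler_wpM2l ?exprn_ge0 //; apply: mx_norm_le => [|i j].
  by rewrite !mulr_ge0 ?exprn_ge0.
rewrite eigencoord_double_opintB expr2 -[leRHS]mulrA.
apply: norm_sum_ord_le => k; apply: norm_sum_ord_le => l.
rewrite normrM ler_pM ?eigencoord_entry_le // !normrM.
rewrite (le_trans (ler_wpM2r _ (phi_le i j k l))) ?mulr_ge0 //.
have P1 := overlap_entry_le1 A A0 i k; have Q1 := overlap_entry_le1 B B0 j l.
have gapA := spectrum_gap_overlap_le i k symA symA0.
have gapB := spectrum_gap_overlap_le j l symB symB0.
rewrite mulrDl lerD //; first by rewrite ler_piMr // mulr_ile1.
rewrite -mulrA ler_wpM2l // mulrDl mulrDr lerD //.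
  by rewrite mulrA (le_trans _ gapA) // ler_piMr ?mulr_ge0.
by rewrite mulrCA (le_trans _ gapB) // ler_piMl ?mulr_ge0.
Qed.

Let box b : set (R * R) := `[- b, b] `*` `[- b, b].

Let compact_box b : compact (box b).
Proof. by apply: compact_setX; exact: segment_compact. Qed.

Let spectrum_box b A B i j : A^T = A -> B^T = B ->
  N2 * `|A| <= b -> N2 * `|B| <= b -> box b (spectrum A 0 i, spectrum B 0 j).
Proof.
move=> symA symB Ab Bb; have := spectrum_le_norm i symA.
have := spectrum_le_norm j symB; rewrite !ler_norml.
by split; rewrite /= in_itv /=; lra.
Qed.

Lemma double_opint_continuous phi A0 B0 (e : R) : continuous phi ->
  A0^T = A0 -> B0^T = B0 -> 0 < e ->
  \forall A \near A0 & B \near B0, A^T = A -> B^T = B -> forall C,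
    `|double_opint phi A B C - double_opint phi A0 B0 C| <= e * `|C|.
Proof.
move=> cphi symA0 symB0 e_gt0.
have N6_gt0 : 0 < N2 ^+ 3 + 1 by rewrite ltr_wpDl ?exprn_ge0.
pose w := e / (2 * (N2 ^+ 3 + 1)); have w_gt0 : 0 < w.
  by rewrite divr_gt0 // mulr_gt0.
pose b := N2 * (`|A0| + `|B0| + 1).
have [K K_ge0 phi_le] := compact_affine_modulus (@compact_box b) cphi w_gt0.
have KN2_ge0 : 0 <= K * N2 by rewrite mulr_ge0 ?exprn_ge0.
have KN2_gt0 : 0 < K * N2 + 1 by rewrite ltr_wpDl.
pose d := w / (2 * (K * N2 + 1)).
have d_gt0 : 0 < d by rewrite divr_gt0 // mulr_gt0.
have in_box M : `|M| <= `|A0| + `|B0| + 1 -> N2 * `|M| <= b.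
  by move=> M_le; rewrite ler_wpM2l ?exprn_ge0.
have A0_lt : `|A0| < `|A0| + `|B0| + 1 by rewrite -addrA ltrDl ltr_wpDl.
have B0_lt : `|B0| < `|A0| + `|B0| + 1 by rewrite addrAC ltrDr ltr_wpDl.
near=> A B => symA symB C.
have Ad : `|A - A0| <= d by near: A; exact: cvgr_distC_le.
have Bd : `|B - B0| <= d by near: B; exact: cvgr_distC_le.
have Ab : N2 * `|A| <= b by apply: in_box; near: A; exact: cvgr_norm_le A0_lt.
have Bb : N2 * `|B| <= b by apply: in_box; near: B; exact: cvgr_norm_le B0_lt.
have A0b : N2 * `|A0| <= b by exact/in_box/ltW.
have B0b : N2 * `|B0| <= b by exact/in_box/ltW.
apply: le_trans (double_opint_sub_le C (ltW w_gt0) K_ge0 _ _ _ _ _) _ => //.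
  move=> i j k l; apply: le_trans (phi_le _ _ _ _) _; try exact: spectrum_box.
  by rewrite lerD2l ler_wpM2l // prod_normE /= ge_max lerDl lerDr !normr_ge0.
have Kd : K * (N2 * (`|A - A0| + `|B - B0|)) <= w.
  have -> : w = (K * N2 + 1) * (d + d) by rewrite /d; field; rewrite gt_eqF.
  by rewrite mulrA ler_pM ?addr_ge0 ?lerD // lerDl.
have -> : e = (N2 ^+ 3 + 1) * (w + w) by rewrite /w; field; rewrite gt_eqF.
rewrite ler_wpM2r // ler_pM ?lerDl ?lerD2l ?exprn_ge0 //.
by rewrite addr_ge0 ?(ltW w_gt0) // !mulr_ge0 ?exprn_ge0 ?addr_ge0.
Unshelve. all: by end_near. Qed.

End ContinuousDoubleOpint.

(** * Differentiability *)

Lemma is_diff_estimate (R : realType) (V W : normedModType R) (f : V -> W)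
    (df : {linear V -> W}) (x : V) : continuous df ->
  (forall e, 0 < e ->
    \forall y \near x, `|f y - f x - df (y - x)| <= e * `|y - x|) ->
  is_diff x f df.
Proof.
move=> cdf est; have df_o : f \o shift x = cst (f x) + df +o_ 0 id.
  apply/eqaddoP => e e_gt0; have /nbhs_ballP[r /= r_gt0 near_x] := est e e_gt0.
  apply/nbhs_ballP; exists r => //= v.
  rewrite -ball_normE/= sub0r normrN => v_lt; have := near_x (v + x).
  rewrite addrK -ball_normE/= opprD addrCA subrr addr0 normrN.
  by move=> /(_ v_lt); rewrite /= opprD addrA.
have dE := diff_unique cdf df_o.
by apply: DiffDef => //; apply/diff_locallyP; rewrite dE.
Qed.

Section SymmetricFamily.
Variables (R : realType) (V : normedModType R) (n : nat).
Variable L : {linear V -> 'M[R]_n}.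
Hypothesis L_continuous : continuous L.
Hypothesis L_sym : forall p, (L p)^T = L p.

Section Derivative.
Variable h : R -> R.
Hypothesis h_derivable : forall t, derivable h t 1.
Hypothesis h1_continuous : continuous (derive1 h).

Let near_double_opint (x : V) e : 0 < e -> \forall y \near x, forall C,
  `|double_opint (ddiff h) (L x) (L y) C -
    double_opint (ddiff h) (L x) (L x) C| <= e * `|C| /\
  `|double_opint (ddiff h) (L y) (L y) C -
    double_opint (ddiff h) (L x) (L x) C| <= e * `|C|.
Proof.
move=> e_gt0; have cdd := ddiff_continuous h_derivable h1_continuous.
have [[P Q] /= [nearP nearQ] PQ] :=
  double_opint_continuous cdd (L_sym x) (L_sym x) e_gt0.
have nearPQ : \forall y \near x, P (L y) /\ Q (L y).
  exact: (L_continuous (filterI nearP nearQ)).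
apply: filterS nearPQ => y [Py Qy] C; split.
  exact: (PQ (L x, L y) (conj (nbhs_singleton nearP) Qy) (L_sym x) (L_sym y)).
exact: (PQ (L y, L y) (conj Py Qy) (L_sym y) (L_sym y)).
Qed.

Lemma is_diff_mxfun x :
  is_diff x (mxfun h \o L) (double_opint (ddiff h) (L x) (L x) \o L).
Proof.
apply: is_diff_estimate => [|e e_gt0].
  move=> p; apply: continuous_comp; first exact: L_continuous.
  exact: mx_linear_continuous.
have [k k_gt0 L_le] := linear_lipschitz L_continuous.
have ek_gt0 : 0 < e / k by rewrite divr_gt0.
apply: filterS (near_double_opint x ek_gt0) => y dd_le.
rewrite /= (linearB L) mxfun_sub //; apply: le_trans (dd_le _).1 _.
rewrite -(linearB L) mulrAC ler_pdivrMr // -mulrA ler_wpM2l ?(ltW e_gt0) //.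
by rewrite mulrC L_le.
Qed.

Variable B : 'M[R]_n.

Let tr_mul : {linear 'M[R]_n -> R} := mxtrace \o mulmxr B.

Let continuous_tr_mul : continuous tr_mul.
Proof. exact: mx_linear_continuous. Qed.

Lemma is_diff_mxtrace_mxfun x : is_diff x (fun p => \tr (mxfun h (L p) *m B))
  (fun v => \tr (double_opint (ddiff h) (L x) (L x) (L v) *m B)).
Proof.
have dtr M : is_diff M tr_mul tr_mul.
  by apply: DiffDef; [apply: linear_differentiable | apply: diff_lin];
    exact: continuous_tr_mul.
exact: is_diff_comp (is_diff_mxfun x) (dtr (mxfun h (L x))).
Qed.

Lemma differentiable_mxtrace_mxfun x :
  differentiable (fun p => \tr (mxfun h (L p) *m B)) x.
Proof. by have df := is_diff_mxtrace_mxfun x; exact: ex_diff. Qed.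

Lemma derive_mxtrace_mxfun v x : 'D_v (fun p => \tr (mxfun h (L p) *m B)) x =
  \tr (double_opint (ddiff h) (L x) (L x) (L v) *m B).
Proof.
have df := is_diff_mxtrace_mxfun x.
by rewrite (deriveE _ (differentiable_mxtrace_mxfun x)) diff_val.
Qed.

Lemma continuous_derive_mxtrace_mxfun v :
  continuous ('D_v (fun p => \tr (mxfun h (L p) *m B))).
Proof.
rewrite (funext (derive_mxtrace_mxfun v)) => x.
apply: (@continuous_comp _ _ _
  (fun p => double_opint (ddiff h) (L p) (L p) (L v)) tr_mul).
  apply/cvgrPdist_le => e e_gt0.
  have e1_gt0 : 0 < e / (`|L v| + 1) by rewrite divr_gt0 // ltr_wpDl.
  apply: filterS (near_double_opint x e1_gt0) => y /(_ (L v))[_ dd_le].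
  rewrite distrC; apply: le_trans dd_le _.
  by rewrite mulrAC ler_pdivrMr ?ltr_wpDl // ler_wpM2l ?(ltW e_gt0) // lerDl.
exact: continuous_tr_mul.
Qed.

End Derivative.

Theorem C2_mxtrace_mxfun h : C2_real h -> C2_on (fun p => \tr (mxfun h (L p))).
Proof.
move=> [dh [dh1 ch2]]; have ch1 := derivable_continuous dh1.
pose F p := \tr (mxfun h (L p)).
have FE : F = fun p => \tr (mxfun h (L p) *m 1%:M).
  by apply/funext => p; rewrite mulmx1.
have D1 v : 'D_v F = fun p => \tr (mxfun (derive1 h) (L p) *m L v).
  apply/funext => x; rewrite FE derive_mxtrace_mxfun // mulmx1.
  rewrite mxtrace_double_opint.
  by congr (\tr (_ *m _)); congr mxfun; apply/funext => t; exact: ddiff_eq.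
split=> [x|]; first by rewrite -/F FE; exact: differentiable_mxtrace_mxfun.
split=> v => [x|w]; rewrite -/F (D1 v).
  exact: (differentiable_mxtrace_mxfun dh1 ch2 (L v) x).
exact: (@continuous_derive_mxtrace_mxfun _ dh1 ch2 (L v) w).
Qed.

End SymmetricFamily.

(** * Convexity *)

Section Convexity.
Variables (R : rcfType) (G dG : R -> R).
Hypothesis G_tangent : forall x y, G x + dG x * (y - x) <= G y.

Lemma tangent_jensen (I : finType) (w x : I -> R) :
  (forall i, 0 <= w i) -> \sum_i w i = 1 ->
  G (\sum_i w i * x i) <= \sum_i w i * G (x i).
Proof.
move=> w_ge0 w1; set m := \sum_i w i * x i.
have -> : G m = \sum_i w i * (G m + dG m * (x i - m)).
  under eq_bigr do rewrite mulrDr mulrCA mulrBr.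
  rewrite big_split/= -mulr_sumr sumrB -/m -!mulr_suml w1 !mul1r.
  by rewrite subrr mulr0 addr0.
by apply: ler_sum => i _; apply: ler_wpM2l.
Qed.

Lemma tangent_convex x y t : 0 <= t <= 1 ->
  G (t * x + (1 - t) * y) <= t * G x + (1 - t) * G y.
Proof.
move=> /andP[t_ge0 t_le1]; have := G_tangent (t * x + (1 - t) * y) x.
have := G_tangent (t * x + (1 - t) * y) y.
by move: (dG _) (G (t * x + _)) => a b; nra.
Qed.

Lemma peierls n (A U : 'M[R]_n) : A^T = A -> orthogonalmx U ->
  \sum_i G ((U *m A *m U^T) i i) <= \tr (mxfun G A).
Proof.
move=> symA UU; pose P := U *m (eigenbasis A)^T.
have PP : orthogonalmx P by apply: orthogonalmxM UU (orthogonalmx_tr _).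
have UAU i : (U *m A *m U^T) i i = \sum_k P i k ^+ 2 * spectrum A 0 k.
  have -> : U *m A *m U^T = P *m diag_mx (spectrum A) *m P^T.
    rewrite {1}(spectral_decE (spectral_decP symA)) /P.
    by rewrite trmx_mul trmxK !mulmxA.
  rewrite mul_mx_diag mxE; apply: eq_bigr => k _.
  by rewrite !mxE expr2 mulrAC.
rewrite mxtrace_mxfun.
apply: (@le_trans _ _ (\sum_i \sum_k P i k ^+ 2 * G (spectrum A 0 k))).
  apply: ler_sum => i _; rewrite UAU; apply: tangent_jensen => [k|].
    exact: sqr_ge0.
  exact: orthogonalmx_sum_row_sqr.
rewrite exchange_big/=; apply: ler_sum => k _; rewrite -mulr_suml.
have := orthogonalmx_sum_row_sqr k (orthogonalmx_tr PP).
by under eq_bigr do rewrite mxE; move=> ->; rewrite mul1r.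
Qed.

Lemma mxtrace_mxfun_convex n (A B : 'M[R]_n) t :
  A^T = A -> B^T = B -> 0 <= t <= 1 ->
  \tr (mxfun G (t *: A + (1 - t) *: B)) <=
  t * \tr (mxfun G A) + (1 - t) * \tr (mxfun G B).
Proof.
move=> symA symB t01; have /andP[t_ge0 t_le1] := t01; set M := t *: A + _.
have symM : M^T = M by rewrite linearD !linearZ /= symA symB.
have orthM := orthogonalmx_eigenbasis M.
have peierlsA := ler_wpM2l t_ge0 (peierls symA orthM).
have peierlsB := ler_wpM2l (_ : 0 <= 1 - t) (peierls symB orthM).
apply: le_trans (lerD peierlsA (peierlsB _)); last by rewrite subr_ge0.
rewrite mxtrace_mxfun !mulr_sumr -big_split/=; apply: ler_sum => i _.
rewrite -!/(eigencoord M M _).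
have -> : spectrum M 0 i =
    t * eigencoord M M A i i + (1 - t) * eigencoord M M B i i.
  have -> : spectrum M 0 i = eigencoord M M M i i.
    by rewrite eigencoord_spectrum // mxE eqxx mulr1n.
  rewrite [in LHS]/M linearD !linearZ mxE.
  by rewrite [X in X + _]mxE [X in _ + X]mxE.
exact: tangent_convex.
Qed.

End Convexity.

(** * Characteristic polynomials *)

Section CharPoly.
Variable R : comUnitRingType.

Lemma char_poly_intertwine n (A B U : 'M[R]_n) :
  U \in unitmx -> U *m A = B *m U -> char_poly A = char_poly B.
Proof.
move=> unitU UA; pose C := map_mx (@polyC R) U.
have lregC : GRing.lreg (\det C).
  apply: lreg_lead; rewrite det_map_mx lead_coefC.
  by apply: mulrI; rewrite -unitmxE.
apply: lregC; rewrite -det_mulmx mulrC -det_mulmx; congr (\det _).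
by rewrite /char_poly_mx mulmxBr mulmxBl -!map_mxM UA scalar_mxC.
Qed.

Lemma char_poly_lblock m n (A : 'M[R]_m) C (B : 'M[R]_n) :
  char_poly (block_mx A 0 C B) = char_poly A * char_poly B.
Proof.
rewrite /char_poly /char_poly_mx map_block_mx map_mx0 scalar_mx_block.
by rewrite opp_block_mx add_block_mx subrr det_lblock.
Qed.

Lemma char_poly_mulmxC n (A B : 'M[R]_n) :
  char_poly (A *m B) = char_poly (B *m A).
Proof.
pose P : 'M[R]_(n + n) := block_mx 1%:M A 0 1%:M.
have unitP : P \in unitmx by rewrite unitmxE det_ublock !det1 mulr1 unitr1.
have PE : P *m block_mx 0 0 B (B *m A) = block_mx (A *m B) 0 B 0 *m P.
  rewrite !mulmx_block !mulmx0 !mul0mx !mulmx1 !mul1mx.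
  by rewrite !addr0 !add0r mulmxA.
have lreg0 : GRing.lreg (char_poly (0 : 'M[R]_n)).
  by apply: lreg_lead; rewrite (monicP (char_poly_monic _)); exact: lreg1.
have := char_poly_intertwine unitP PE.
by rewrite !char_poly_lblock [RHS]mulrC => /lreg0/esym.
Qed.

End CharPoly.

Lemma char_poly_spectral_dec (R : comUnitRingType) n (A U : 'M[R]_n) d :
  spectral_dec A U d -> char_poly A = \prod_(x <- codom (d 0)) ('X - x%:P).
Proof.
move=> [/mulmx1_unit[unitU _] UA]; rewrite (char_poly_intertwine unitU UA).
rewrite char_poly_trig ?diag_mx_is_trig // big_map big_enum.
by apply: eq_bigr => i _; rewrite mxE eqxx.
Qed.

Lemma char_poly_eigenvalues (R : realType) n (A : 'M[R]_n) : A^T = A ->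
  char_poly A = \prod_(x <- eigenvalues A) ('X - x%:P).
Proof.
move=> symA; rewrite /eigenvalues; case: xgetP => [s -> [] //|/= no_spectrum].
have [U [d sA]] := symmetric_spectral_dec symA.
case: (no_spectrum (codom (d 0))); split; last exact: char_poly_spectral_dec sA.
by rewrite size_map -cardE card_ord.
Qed.

(** * The symmetric dilation of a matrix *)

Section Dilation.
Variables (R : nzRingType) (m n : nat).

Definition dilation (p : 'M[R]_(m, n)) : 'M[R]_(m + n) := block_mx 0 p p^T 0.

Lemma dilation_sym p : (dilation p)^T = dilation p.
Proof. by rewrite /dilation tr_block_mx !trmx0 trmxK. Qed.

Lemma dilation_sqr p :
  dilation p *m dilation p = block_mx (p *m p^T) 0 0 (p^T *m p).
Proof. by rewrite mulmx_block !mulmx0 !mul0mx !addr0 !add0r. Qed.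

Lemma dilation_linear : linear dilation.
Proof.
move=> a p q; rewrite /dilation linearP scale_block_mx add_block_mx.
by rewrite !scaler0 !addr0.
Qed.

HB.instance Definition _ :=
  GRing.isLinear.Build R 'M[R]_(m, n) 'M[R]_(m + n) *:%R dilation
    dilation_linear.

End Dilation.

Lemma perm_eq_sigmas_dilation (R : realType) n (p : 'M[R]_n) U d :
  spectral_dec (dilation p) U d ->
  perm_eq (sigmas p ++ sigmas p) [seq d 0 i ^+ 2 | i : 'I_(n + n)].
Proof.
move=> /spectral_dec_sqr/char_poly_spectral_dec sD.
have -> : [seq d 0 i ^+ 2 | i : 'I_(n + n)] = codom ((\row_i (d 0 i ^+ 2)) 0).
  by apply: eq_codom => i; rewrite mxE.
apply: prod_XsubC_eq; rewrite -sD dilation_sqr char_poly_lblock.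
rewrite (char_poly_mulmxC p^T).
by rewrite big_cat/= -char_poly_eigenvalues // trmx_mul trmxK.
Qed.

Lemma sum_sigmas (R : realType) n (p : 'M[R]_n) (g : R -> R) :
  \sum_(s <- sigmas p) g s =
  2^-1 * \tr (mxfun (fun t => g (t ^+ 2)) (dilation p)).
Proof.
rewrite mxtrace_mxfun; have sD := spectral_decP (dilation_sym p).
have : \sum_(s <- sigmas p ++ sigmas p) g s = _ :=
  perm_big _ (perm_eq_sigmas_dilation sD).
by rewrite big_cat/= big_map big_enum/= => <-; field.
Qed.

(** * The quartic norm *)

Section QuarticNorm.
Variables (R : realType) (eps : R).
Hypothesis eps_gt0 : 0 < eps.

(* At [s = t ^+ 2], this is the argument of [psi] in [Fstar]. *)
Definition quartic_norm (t : R) : R :=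
  Num.sqrt (Num.sqrt (eps ^+ 2 + t ^+ 4)).

Local Notation rho := quartic_norm.

Lemma quartic_gt0 t : 0 < eps ^+ 2 + t ^+ 4.
Proof. by rewrite ltr_wpDr ?(exprM t 2 2) ?sqr_ge0 // exprn_gt0. Qed.

Lemma quartic_norm_gt0 t : 0 < rho t.
Proof. by rewrite !sqrtr_gt0 quartic_gt0. Qed.

Lemma quartic_norm_exp4 t : rho t ^+ 4 = eps ^+ 2 + t ^+ 4.
Proof. by rewrite (exprM _ 2 2) !sqr_sqrtr ?sqrtr_ge0 // ltW ?quartic_gt0. Qed.

Lemma is_derive_quartic_norm (t : R) : is_derive t 1 rho (t ^+ 3 / rho t ^+ 3).
Proof.
pose q (t : R) := eps ^+ 2 + t ^+ 4.
have dq : is_derive t 1 q (4 * t ^+ 3).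
  have dX : is_derive t 1 q _ :=
    is_deriveD (is_derive_cst (eps ^+ 2) t 1) (is_deriveX 4 (is_derive_id t 1)).
  by apply: is_derive_eq dX _; rewrite /GRing.scale/=; ring.
have q_gt0 : 0 < q t := quartic_gt0 t.
have sqrt_q_gt0 : 0 < Num.sqrt (q t) by rewrite sqrtr_gt0.
have dsqrt := is_derive1_comp (is_derive1_sqrt q_gt0) dq.
have := @is_derive1_comp R Num.sqrt (Num.sqrt \o q) t _ _
  (is_derive1_sqrt sqrt_q_gt0) dsqrt.
move/is_derive_eq; apply; rewrite -[Num.sqrt (Num.sqrt (q t))]/(rho t).
have -> : Num.sqrt (q t) = rho t ^+ 2 by rewrite sqr_sqrtr // sqrtr_ge0.
by field; rewrite gt_eqF // quartic_norm_gt0.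
Qed.

Lemma is_derive2_quartic_norm (t : R) :
  is_derive t 1 (fun t => t ^+ 3 / rho t ^+ 3)
    (3 * eps ^+ 2 * t ^+ 2 / rho t ^+ 7).
Proof.
have r_neq0 : rho t != 0 by rewrite gt_eqF // quartic_norm_gt0.
have r3_neq0 : (rho ^+ 3) t != 0 := expf_neq0 3 r_neq0.
have dr3 := is_deriveX 3 (is_derive_quartic_norm t).
have := is_deriveM (is_deriveX 3 (is_derive_id t 1)) (is_deriveV r3_neq0 dr3).
move/is_derive_eq; apply; rewrite /GRing.scale/=.
rewrite -[(rho ^+ 3) t]/(rho t ^+ 3) -[(id ^+ 3) t]/(t ^+ 3).
have -> : eps ^+ 2 = rho t ^+ 4 - t ^+ 4 by rewrite quartic_norm_exp4; ring.
by field.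
Qed.

Lemma C2_quartic_norm : C2_real rho.
Proof.
apply: is_derive_C2_real is_derive_quartic_norm is_derive2_quartic_norm _ => t.
have crho : continuous rho.
  by apply: derivable_continuous => x; case: (is_derive_quartic_norm x).
apply: cvgM.
  by apply: cvgM; [exact: cvg_cst | exact: exprn_continuous].
apply: cvgV; first by rewrite expf_neq0 // gt_eqF // quartic_norm_gt0.
exact: (@continuous_comp _ _ _ rho (fun s => s ^+ 7) t (crho t)
  (@exprn_continuous _ _ _)).
Qed.

Lemma derive2_quartic_norm_ge0 t : 0 <= derive1 (derive1 rho) t.
Proof.
rewrite (derive1_is_derive is_derive_quartic_norm).
rewrite (derive1_is_derive is_derive2_quartic_norm).
rewrite divr_ge0 ?exprn_ge0 ?(ltW (quartic_norm_gt0 t)) //.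
by rewrite mulr_ge0 ?sqr_ge0 // mulr_ge0 ?sqr_ge0.
Qed.

End QuarticNorm.

Lemma Fstar_mxtrace (R : realType) n (psi : R -> R) (eps : R) (p : 'M[R]_n) :
  Fstar psi eps p =
  \tr (mxfun (fun t => 2^-1 * psi (quartic_norm eps t)) (dilation p)).
Proof.
rewrite /Fstar (sum_sigmas p
  (fun s => psi (Num.sqrt (Num.sqrt (eps ^+ 2 + s ^+ 2))))).
rewrite !mxtrace_mxfun mulr_sumr; apply: eq_bigr => i _.
by rewrite /quartic_norm -exprM.
Qed.

Theorem theorem4p1 (R : realType) (n : nat) (eps nu1 nu2 nu3 : R)
  (psi : R -> R) :
  (0 < n)%N -> 0 < eps -> 0 < nu1 -> 0 < nu2 ->
  (forall y, 0 <= psi y) ->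
  C2_real psi ->
  (forall y, psi (- y) = psi y) ->
  psi 0 = 0 ->
  (forall y, `|derive1 psi y| <= nu1) ->
  (forall y, nu2 * `|y| - nu3 <= psi y) ->
  (forall y, 0 < derive1 (derive1 psi) y) ->
  convex_fun (@Fstar R n psi eps) /\ C2_on (@Fstar R n psi eps).
Proof.
move=> _ eps_gt0 _ _ psi_ge0 C2psi _ psi0 _ _ psi2_gt0.
have psi2_ge0 y := ltW (psi2_gt0 y).
pose f := psi \o quartic_norm eps.
have C2rho := C2_quartic_norm eps_gt0.
have C2f : C2_real f := C2_real_comp C2psi C2rho.
have f2_ge0 t : 0 <= derive1 (derive1 f) t.
  apply: derive2_comp_ge0 => //; last exact: derive2_quartic_norm_ge0.
  apply: (derive1_ge0_gt_min C2psi.1 C2psi.2.1 (a := 0)) => // [y|].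
    by rewrite psi0.
  exact: quartic_norm_gt0.
have -> : @Fstar R n psi eps =
    fun p => \tr (mxfun (fun t => 2^-1 * f t) (dilation p)).
  exact/funext/Fstar_mxtrace.
split; last first.
  apply: C2_mxtrace_mxfun; first exact: mx_linear_continuous.
    exact: dilation_sym.
  exact: C2_realMl.
move=> p q t t01; rewrite linearD !linearZ.
apply: (@mxtrace_mxfun_convex _ _ (fun t => 2^-1 * derive1 f t)) => // [x y||].
- by rewrite -mulrA -mulrDr ler_wpM2l // (derive2_ge0_tangent C2f.1 C2f.2.1).
- exact: dilation_sym.
- exact: dilation_sym.
Qed.
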